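(* Let $\mathbb{F}_q$ be a finite field of order $q$ ($q$ a prime power), let $G=(V,E)$ be a network as in the context with set of sink nodes $T$, and let $\omega\ge1$ be an integer with $C_t\ge\omega$ for all $t\in T$. For $t\in T$ let $\delta_t=C_t-\omega$. If $$q>\sum_{t\in T}\big|\mathcal{A}_t(\delta_t)\big|,$$ then there exists an $\mathbb{F}_q$-valued rate-$\omega$ LNEC MDS code on $G$, i.e., an $\mathbb{F}_q$-valued rate-$\omega$ LNEC code with $\dim\Phi(t)=\omega$ and $d_{\min}^{(t)}=C_t-\omega+1$ for every $t\in T$.
   Context: Network: $G=(V,E)$ is a finite directed acyclic graph (parallel edges allowed) with a single source node $s$ and a set of sink nodes $T\subseteq V\setminus\{s\}$; $s$ has no incoming edges and sink nodes have no outgoing edges. For an edge $e$, $\mathrm{tail}(e)$, $\mathrm{head}(e)$ are its tail and head; $\mathrm{In}(v)$, $\mathrm{Out}(v)$ are the incoming/outgoing edge sets of node $v$. A directed path is a sequence of edges $(e_1,\dots,e_m)$, $m\ge1$, with $\mathrm{tail}(e_{k+1})=\mathrm{head}(e_k)$. A cut separating node $v$ from node $u$ is a set of edges whose removal leaves no directed path from $u$ to $v$; $C_t$ is the minimum size of a cut separating sink $t$ from $s$. LNEC code: with rate $\omega$ and finite field $\mathbb{F}_q$, introduce imaginary source edges $d_1',\dots,d_\omega'$ ending at $s$ with $\mathrm{In}(s)=\{d_1',\dots,d_\omega'\}$, and for each $e\in E$ an imaginary error edge $e'$ with head $\mathrm{tail}(e)$; $E'=\{e':e\in E\}$ (for non-source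 nodes, $\mathrm{In}(v)$ contains only edges of $E$). An $\mathbb{F}_q$-valued rate-$\omega$ LNEC code is given by local encoding coefficients $k_{d,e}\in\mathbb{F}_q$ for $e\in E$, $d\in\mathrm{In}(\mathrm{tail}(e))$. Extended global encoding kernels are vectors in $\mathbb{F}_q^{\omega+|E|}$ indexed by $\{d_i'\}\cup E'$: $\tilde f_{d_i'}=1_{d_i'}$, $\tilde f_{e'}=1_{e'}$ (standard basis vectors), and recursively in topological order $\tilde f_e=\sum_{d\in\mathrm{In}(\mathrm{tail}(e))}k_{d,e}\tilde f_d+1_{e'}$. For sink $t$, $\mathrm{row}_t(d')=(\tilde f_{\hat e}(d'):\hat e\in\mathrm{In}(t))$. Message space $\Phi(t)=\langle\mathrm{row}_t(d_i'):1\le i\le\omega\rangle$; error space $\Delta(t,\xi)=\langle\mathrm{row}_t(e'):e\in\xi\rangle$ for $\xi\subseteq E$. Minimum distance at $t$: $d_{\min}^{(t)}=\min\{|\xi|:\xi\subseteq E,\ \Phi(t)\cap\Delta(t,\xi)\neq\{0\}\}$. Graph notions: for $\xi\subseteq E$ and a node $u$, $A\subseteq E$ is a cut separating $u$ from $\xi$ if every directed path in $G$ whose first edge lies in $\xi$ and whose last edge has head $u$ contains an edge of $A$; $\mathrm{mincut}(\xi,u)$ is the minimum size of such a cut. A minimum cut separating $u$ from $\xi$ is primary if it separates $u$ from every minimum cut separating $u$ from $\xi$; it exists and is unique. $\xi$ is primary for $u$ if $\xi$ is the primary minimum cut separating $u$ from $\xi$. $\mathcal{A}_t(r)=\{\xi\subseteq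 E:|\xi|=r,\ \xi\text{ primary for }t\}$. *)

(* Defs.v *)
From HB Require Import structures.
From mathcomp Require Import all_boot all_order all_algebra.
From mathcomp Require Import boolp.

Set Implicit Arguments.
Unset Strict Implicit.
Unset Printing Implicit Defensive.

Import GRing.Theory.

(* A network: nodes V, edges E (finite types; parallel edges allowed since
   edges are abstract elements of E), with tail tl and head hd. *)
Section Network.
Variables (V E : finType) (tl hd : E -> V).

Definition econs : rel E := fun d e => hd d == tl e.

(* A directed path is represented as (e0 :: p) with path econs e0 p;
   its first edge is e0 and its last edge is last e0 p. *)
Definition acyclic : Prop :=
  forall (e0 : E) (p : seq E), path econs e0 p -> hd (last e0 p) <> tl e0.

Definition sep_nodes (A : {set E}) (u v : V) : Prop :=
  forall (e0 : E) (p : seq E), path econs e0 p ->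
    tl e0 = u -> hd (last e0 p) = v -> exists2 e, e \in e0 :: p & e \in A.

(* minimum size of a cut separating v from u (setT is always such a cut,
   so the default value #|E| of the minimum is never the only candidate) *)
Definition mincut_nodes (u v : V) : nat :=
  \big[minn/#|E|]_(A : {set E} | `[< sep_nodes A u v >]) #|A|.

Definition sep_from (A xi : {set E}) (u : V) : Prop :=
  forall (e0 : E) (p : seq E), path econs e0 p ->
    e0 \in xi -> hd (last e0 p) = u -> exists2 e, e \in e0 :: p & e \in A.

Definition mincut_from (xi : {set E}) (u : V) : nat :=
  \big[minn/#|E|]_(A : {set E} | `[< sep_from A xi u >]) #|A|.

Definition is_mincut_from (A xi : {set E}) (u : V) : Prop :=
  sep_from A xi u /\ #|A| = mincut_from xi u.

Definition is_primary_mincut (A xi : {set E}) (u : V) : Prop :=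
  is_mincut_from A xi u /\
  forall B : {set E}, is_mincut_from B xi u -> sep_from A B u.

Definition primary_for (xi : {set E}) (u : V) : Prop :=
  is_primary_mincut xi xi u.

Definition A_set (t : V) (r : nat) : {set {set E}} :=
  [set xi : {set E} | (#|xi| == r) && `[< primary_for xi t >]].

Variables (F : fieldType) (s : V) (omega : nat).

(* Coordinates of extended global encoding kernels: inl i is the imaginary
   source edge d_i', inr e is the imaginary error edge e'.
   Local encoding coefficients: ks i e = k_{d_i',e} (used when tail e = s),
   kd d e = k_{d,e} for real edges d with head d = tail e. *)
Definition kernel := E -> ('I_omega + E) -> F.

Definition gk_step (ks : 'I_omega -> E -> F) (kd : E -> E -> F)
    (f : kernel) : kernel :=
  fun e x =>
    ((if tl e == s then \sum_(i < omega) ks i e * (x == inl i)%:R else 0)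
     + \sum_(d : E | hd d == tl e) kd d e * f d x
     + (x == inr e)%:R)%R.

(* Extended global encoding kernels: the recursion
   f_e = sum_{d in In(tail e)} k_{d,e} f_d + 1_{e'}  (f_{d_i'} = 1_{d_i'})
   computed by iterating it #|E| times from 0; on an acyclic network this
   is exactly the recursive definition in topological order. *)
Definition gkernel ks kd : kernel := iter #|E| (gk_step ks kd) (fun _ _ => 0%R).

Definition In_edges (t : V) : {set E} := [set e | hd e == t].

Definition row_t ks kd (t : V) (x : 'I_omega + E) : 'rV[F]_#|In_edges t| :=
  \row_(j < #|In_edges t|) gkernel ks kd (enum_val j) x.

(* matrix whose row space is Phi(t) *)
Definition PhiM ks kd (t : V) : 'M[F]_(omega, #|In_edges t|) :=
  \matrix_(i < omega) row_t ks kd t (inl i).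

(* matrix whose row space is Delta(t, xi) *)
Definition DeltaM ks kd (t : V) (xi : {set E}) : 'M[F]_(#|xi|, #|In_edges t|) :=
  \matrix_(i < #|xi|) row_t ks kd t (inr (enum_val i)).

(* minimum distance at t (default #|E|.+1 if no xi qualifies) *)
Definition dmin ks kd (t : V) : nat :=
  \big[minn/#|E|.+1]_(xi : {set E} | (PhiM ks kd t :&: DeltaM ks kd t xi)%MS != 0%R)
     #|xi|.

End Network.

(* Main.v *)
Require Import Defs.
From HB Require Import structures.
From mathcomp Require Import all_boot all_order all_algebra.
From mathcomp Require Import boolp.
From mathcomp Require Import zify ring.

(* It suffices that, for every sink t and every xi in A_t(delta_t), the omega
   message rows and the delta_t error rows of xi are linearly independent at t:
   an error pattern of size at most delta_t is cut off from t by some xi in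
   A_t(delta_t), so its error space is contained in that of xi. For each such
   pair (t, xi) some code has this independence: by Menger's theorem there are
   C_t disjoint paths from the messages and xi to t, and one routes along them.
   Changing one local coefficient changes the matrix at t by a rank-one term,
   affinely in the coefficient because the network is acyclic; hence a pair that
   can still be satisfied forbids at most one value of the next coefficient, and
   q > number of pairs allows all coefficients to be chosen in turn. Finally,
   the message space factors through a minimum cut of size C_t, and killing
   omega - 1 of its coordinates gives the Singleton bound. *)

Set Implicit Arguments.
Unset Strict Implicit.
Unset Printing Implicit Defensive.

Import GRing.Theory.

(** * Minima with a default value *)

Section BigMin.
Variables (I : finType) (d : nat) (P : pred I) (f : I -> nat).

Lemma bigminn_le i : P i -> \big[minn/d]_(j | P j) f j <= f i.
Proof.
move=> Pi; have: i \in index_enum I by rewrite mem_index_enum.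
elim: (index_enum I) => // j r IH; rewrite inE big_cons.
case/orP=> [/eqP<-|/IH le_i]; first by rewrite Pi geq_minl.
by case: (P j) => //; apply: leq_trans le_i; apply: geq_minr.
Qed.

Lemma le_bigminn m :
  m <= d -> (forall i, P i -> m <= f i) -> m <= \big[minn/d]_(j | P j) f j.
Proof.
move=> le_d le_f; apply: (big_ind (fun n => m <= n)) => // x y mx my.
by rewrite leq_min mx.
Qed.

(** The fold yields [d] or an attained value. In the first case [f i0 <= d] forces [i0] itself to
    attain the minimum. *)
Lemma bigminn_attained i0 :
  P i0 -> f i0 <= d -> exists2 i, P i & f i = \big[minn/d]_(j | P j) f j.
Proof.
move=> Pi0 le_d; have := bigminn_le Pi0; move Em: (\big[_/_]_(j | P j) f j) => m.
have [-> le_i0|//] : m = d \/ exists2 i, P i & f i = m.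
  rewrite -Em; apply: (big_ind (fun m => m = d \/ exists2 i, P i & f i = m)).
  - by left.
  - by move=> x y Hx Hy; rewrite /minn; case: ifP.
  - by move=> i Pi; right; exists i.
by exists i0 => //; apply/eqP; rewrite eqn_leq le_d.
Qed.

End BigMin.

(** * Hall's marriage theorem *)

(* Rado's argument: in a family of minimal total size satisfying the marriage
   condition, every member is a singleton. *)
Lemma hall_marriage (X Z : finType) (P : {set X}) (N : X -> {set Z}) :
    (forall Y : {set X}, Y \subset P -> #|Y| <= #|\bigcup_(y in Y) N y|) ->
  exists f : X -> option Z,
    (forall y, y \in P -> exists2 z, f y = Some z & z \in N y) /\
    {in P &, injective f}.
Proof.
have [n] := ubnP (\sum_(y in P) #|N y|); elim: n N => // n IH N le_n hall.
have nonempty y : y \in P -> exists z, z \in N y.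
  move=> yP; apply/set0Pn; rewrite -card_gt0.
  by have := hall [set y]; rewrite sub1set big_set1 cards1; apply.
case: (boolP [exists y in P, 1 < #|N y|]) => [/existsP[y /andP[yP]]|small].
  case/card_gt1P=> a [b [aN bN neq_ab]].
  pose rm c x := if x == y then N y :\ c else N x.
  have shrink c : c \in N y ->
      (forall Y : {set X}, Y \subset P -> #|Y| <= #|\bigcup_(x in Y) rm c x|) ->
      exists f : X -> option Z,
        (forall y, y \in P -> exists2 z, f y = Some z & z \in N y) /\
        {in P &, injective f}.
    move=> cN hallc; have lt_n : \sum_(x in P) #|rm c x| < n.
      apply: leq_trans (le_n : _ <= n).
      rewrite (bigD1 y) //= [X in _ < X](bigD1 y) //= /rm eqxx.
      rewrite (cardsD1 c (N y)) cN add1n addSn ltnS leq_add2l.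
      by apply: leq_sum => x /andP[_ /negPf->].
    have [f [fN finj]] := IH (rm c) lt_n hallc; exists f; split=> // x xP.
    have [z fz] := fN x xP; rewrite /rm; case: eqP => [xy|_]; last by exists z.
    by rewrite !inE xy => /andP[_ zN]; exists z => //; rewrite -xy.
  (* If deleting [c] from [N y] breaks Hall's condition, the violating set must contain [y]; the
     witness is that set without [y]. *)
  have violated c : c \in N y ->
      ~ (forall Y : {set X}, Y \subset P -> #|Y| <= #|\bigcup_(x in Y) rm c x|) ->
      exists2 Y : {set X}, (y \notin Y) && (Y \subset P) &
        #|\bigcup_(x in Y) N x :|: (N y :\ c)| <= #|Y|.
    move=> cN /existsNP[Y /not_implyP[sYP /negP]]; rewrite -ltnNge => ltY.
    have yY : y \in Y.
      apply/negPn/negP => yNY; have := hall Y sYP; rewrite leqNgt => /negP[].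
      rewrite (eq_bigr (rm c)) // => x xY; rewrite /rm; case: eqP => // xy.
      by rewrite -xy xY in yNY.
    exists (Y :\ y); first by rewrite !inE eqxx (subset_trans (subD1set _ _)).
    move: ltY; rewrite (cardsD1 y Y) yY ltnS; congr (#|pred_of_set _| <= _).
    rewrite (bigD1 y) //= /rm eqxx setUC; congr (_ :|: _).
    by apply: eq_big => [x|x /andP[_ /negPf->]] //; rewrite !inE andbC.
  case: (pselect (forall Y : {set X}, Y \subset P -> #|Y| <= #|\bigcup_(x in Y) rm a x|)).
    exact: shrink.
  move/(violated a aN)=> [Y1 /andP[yY1 sY1] le1].
  case: (pselect (forall Y : {set X}, Y \subset P -> #|Y| <= #|\bigcup_(x in Y) rm b x|)).
    exact: shrink.
  move/(violated b bN)=> [Y2 /andP[yY2 sY2] le2].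
  set U1 := (X in #|pred_of_set X| <= _) in le1.
  set U2 := (X in #|pred_of_set X| <= _) in le2.
  (* As [a] and [b] differ, the union of [U1] and [U2] recovers all of [N y]. Counting union and
     intersection together then gives |Y1| + |Y2| + 1 <= |U1| + |U2| <= |Y1| + |Y2|. *)
  have geU : #|y |: (Y1 :|: Y2)| <= #|U1 :|: U2|.
    apply: leq_trans (hall _ _) _; first by rewrite !subUset sub1set yP sY1.
    apply/subset_leq_card/bigcupsP => x; rewrite !inE.
    case/orP=> [/eqP->|/orP[xY|xY]].
    - apply/subsetP=> z zN; rewrite !inE zN.
      case: (eqVneq z a) => [->|_]; last by rewrite orbT.
      by rewrite neq_ab !orbT.
    - by apply/subsetU/orP; left; apply/subsetU/orP; left; exact: (bigcup_sup x).
    - by apply/subsetU/orP; right; apply/subsetU/orP; left; exact: (bigcup_sup x).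
  have geI : #|Y1 :&: Y2| <= #|U1 :&: U2|.
    apply: leq_trans (hall _ _) _; first by apply: subset_trans sY1; apply: subsetIl.
    apply/subset_leq_card/bigcupsP => x; rewrite inE => /andP[xY1 xY2].
    rewrite subsetI; apply/andP; split; apply/subsetU/orP; left.
      exact: (bigcup_sup x).
    exact: (bigcup_sup x).
  move: geU; rewrite cardsU1 !inE negb_or yY1 yY2 /= => geU.
  have := cardsUI U1 U2; have := cardsUI Y1 Y2; lia.
exists (fun y => [pick z in N y]); split=> [y yP|x y xP yP].
  have [z zN] := nonempty y yP; case: pickP => [z' z'N|/(_ z)]; last by rewrite zN.
  by exists z'.
have single u a b : u \in P -> a \in N u -> b \in N u -> a = b.
  move=> uP aN bN; apply/eqP/negPn/negP => neq; case/negP: small.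
  by apply/existsP; exists u; rewrite uP; apply/card_gt1P; exists a, b.
case: pickP => [z zx|nox]; last by have [z] := nonempty x xP; rewrite nox.
case: pickP => // z' zy [zz']; subst z'.
apply/eqP/negPn/negP => neq.
have := hall [set x; y]; rewrite subUset !sub1set xP yP cards2 neq => /(_ isT).
rewrite bigcup_setU !big_set1 leqNgt => /negP[].
rewrite (@leq_ltn_trans #|[set z]|) ?cards1 // -(cards1 z) subset_leq_card //; apply/subsetP=> w.
by rewrite !inE => /orP[] wN; apply/eqP; [apply: (single x)|apply: (single y)].
Qed.

(** * Cuts and primary minimum cuts *)

Section Cuts.
Variables (V E : finType) (tl hd : E -> V).
Implicit Types (A B S xi : {set E}) (e f : E) (t : V).

Local Notation sep_from := (sep_from tl hd).
Local Notation sep_nodes := (sep_nodes tl hd).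
Local Notation mincut_from := (mincut_from tl hd).
Local Notation mincut_nodes := (mincut_nodes tl hd).

Lemma mincut_from_le A xi t : sep_from A xi t -> mincut_from xi t <= #|A|.
Proof.
by move=> sepA; apply: (@bigminn_le _ _ _ (fun A : {set E} => #|A|)); apply/asboolP.
Qed.

Lemma mincut_nodes_le A s t : sep_nodes A s t -> mincut_nodes s t <= #|A|.
Proof.
by move=> sepA; apply: (@bigminn_le _ _ _ (fun A : {set E} => #|A|)); apply/asboolP.
Qed.

Lemma mincut_nodes_max s t : mincut_nodes s t <= #|E|.
Proof.
rewrite -cardsT; apply: mincut_nodes_le => e p _ _ _.
by exists e; rewrite ?inE ?eqxx.
Qed.

Lemma mincut_nodes_attained s t :
  exists2 A : {set E}, sep_nodes A s t & #|A| = mincut_nodes s t.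
Proof.
have [||A /asboolP sepA] :=
    @bigminn_attained {set E} #|E| (fun A => `[< sep_nodes A s t >])
      (fun A => #|A|) setT.
- by apply/asboolP => e p _ _ _; exists e; rewrite ?inE ?eqxx.
- by rewrite cardsT.
by exists A.
Qed.

(** The part of a path that starts at an edge of [A] is itself a path, so it meets [B]. *)
Lemma sep_from_trans A B xi t :
  sep_from A xi t -> sep_from B A t -> sep_from B xi t.
Proof.
move=> sepA sepB e0 p pth e0xi ht.
have {sepA e0xi} := sepA e0 p pth e0xi ht.
elim: p e0 pth ht => [|f p IH] e0 pth ht [e e_in eA].
  by apply: sepB => //; move: e_in; rewrite inE => /eqP<-.
move: e_in; rewrite inE => /orP[/eqP ee0|ep].
  by apply: sepB => //; rewrite -ee0.
have /andP[_ pthf] : econs tl hd e0 f && path (econs tl hd) f p by [].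
have [g gp gB] := IH f pthf ht (ex_intro2 _ _ e ep eA).
by exists g => //; rewrite inE gp orbT.
Qed.

(** A closure operator on edge sets: it turns separation into inclusion, see [separatedP]. *)
Definition separated A t : {set E} := [set e | `[< sep_from A [set e] t >]].

Definition boundary S t : {set E} :=
  [set e in S | (hd e == t) || [exists f, econs tl hd e f && (f \notin S)]].

Lemma separatedP A xi t : reflect (sep_from A xi t) (xi \subset separated A t).
Proof.
apply: (iffP subsetP) => [sub e p pth exi ht|sep e exi].
  by have := sub e exi; rewrite inE => /asboolP/(_ e p pth); apply; rewrite ?inE.
by rewrite inE; apply/asboolP=> f p pth; rewrite inE => /eqP fe; apply: sep => //; rewrite fe.
Qed.

Lemma sub_separated A t : A \subset separated A t.
Proof. by apply/separatedP=> e p _ eA _; exists e; rewrite ?inE ?eqxx. Qed.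

Lemma separated_next A t e f :
  e \in separated A t -> e \notin A -> econs tl hd e f -> f \in separated A t.
Proof.
rewrite inE => /asboolP sep eNA ef; rewrite inE; apply/asboolP=> f' p pth.
rewrite inE => /eqP ff' ht; subst f'.
have [|||g] := sep e (f :: p); rewrite /= ?ef ?inE //.
by case/orP=> [/eqP->|gp gA]; [rewrite (negPf eNA)|exists g].
Qed.

Lemma separated_head A t e : e \in separated A t -> e \notin A -> hd e != t.
Proof.
rewrite inE => /asboolP sep eNA; apply/eqP=> het.
have [|||g] := sep e [::]; rewrite /= ?inE //.
by move/eqP->; apply/negP.
Qed.

Lemma boundary_sep S t : sep_from (boundary S t) S t.
Proof.
move=> e p; elim: p e => [|f p IH] e pth eS ht.
  by exists e; rewrite ?inE ?eqxx // eS; apply/orP; left; apply/eqP.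
move: pth => /= /andP[ef pth].
case: (boolP (f \in S)) => fS; last first.
  exists e; rewrite ?inE ?eqxx // eS; apply/orP; right.
  by apply/existsP; exists f; rewrite ef.
by have [g gp gB] := IH f pth fS ht; exists g => //; rewrite inE gp orbT.
Qed.

(** An edge of the closure outside [A] neither ends at [t] nor feeds an edge outside the closure. So
    replacing a cut by the boundary of its closure never enlarges it. *)
Lemma boundary_separated A t : boundary (separated A t) t \subset A.
Proof.
apply/subsetP=> e; rewrite inE => /andP[eS]; apply: contraLR => eNA.
rewrite negb_or (separated_head eS eNA) negb_exists /=; apply/forallP=> f.
by rewrite negb_and negbK; case: (boolP (econs _ _ _ _)) => //= /(separated_next eS eNA).
Qed.

(* Among the sets containing [xi] whose boundary has at most [r] edges, an
   inclusion-maximal one has a boundary of exactly [r] edges, and no other cut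
   of the same size lies closer to [t]. *)
Lemma primary_extension xi s t r :
    #|xi| <= r -> r < mincut_nodes s t ->
  exists2 A, A \in A_set tl hd t r & sep_from A xi t.
Proof.
move=> xi_r r_cut.
pose Q S := (xi \subset S) && (#|boundary S t| <= r).
have [|S /maxsetP[/andP[xiS Sr] Smax] _] := @maxset_exists _ Q (separated xi t).
  rewrite /Q sub_separated (leq_trans _ xi_r) //.
  exact/subset_leq_card/boundary_separated.
pose A := boundary S t.
have cardA : #|A| = r.
  apply/eqP; rewrite eqn_leq Sr leqNgt; apply/negP=> ltA.
  (* Adding an edge to [S] adds at most that edge to the boundary, against maximality. If [S]
     contains every edge, its boundary is a cut between [s] and [t] with at most [r] edges. *)
  case: (pickP (fun e => e \notin S)) => [e eNS|allS].
    have /Smax : Q (e |: S).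
      rewrite /Q (subset_trans xiS) ?subsetUr //=.
      apply: leq_trans ltA; apply: leq_trans (_ : #|e |: A| <= _); last first.
        by rewrite cardsU1; case: (_ \notin _).
      apply/subset_leq_card/subsetP=> f; rewrite !inE => /andP[].
      case: (f == e) => //= fS /orP[->|/existsP[g /andP[fg]]]; rewrite fS ?orbT //=.
      rewrite !inE negb_or => /andP[_ gNS].
      by apply/orP; right; apply/existsP; exists g; rewrite fg.
    move/(_ (subsetUr _ _)) => eqS; case/negP: eNS.
    by rewrite -eqS !inE eqxx.
  have: mincut_nodes s t <= #|A|.
    apply: mincut_nodes_le => e p pth _ ht; apply: boundary_sep pth _ ht.
    by apply/negPn; rewrite allS.
  by move/(leq_trans r_cut); rewrite ltnNge Sr.
(* Such a [B] also cuts off [S], so its closure contains [S] and has a boundary inside [B];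
   maximality makes the closure equal to [S]. *)
have closer B : sep_from B A t -> #|B| <= r ->
    #|A| <= #|B| /\ B \subset S.
  move=> sepB Br; have sepBS := sep_from_trans (@boundary_sep S t) sepB.
  have sSB : S \subset separated B t by apply/separatedP.
  have /Smax/(_ sSB) eqS : Q (separated B t).
    rewrite /Q (subset_trans xiS) //= (leq_trans _ Br) //.
    exact/subset_leq_card/boundary_separated.
  rewrite -eqS sub_separated /A -eqS; split=> //.
  exact/subset_leq_card/boundary_separated.
have sepAA : sep_from A A t by apply/separatedP/sub_separated.
have minA : #|A| = mincut_from A t.
  apply/eqP; rewrite eqn_leq mincut_from_le // andbT.
  apply: le_bigminn => [|B /asboolP sepB]; first exact: max_card.
  case: (leqP #|B| r) => [/(closer B sepB)[]//|].
  by rewrite -cardA => /ltnW.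
exists A; last by apply/separatedP/(subset_trans xiS)/separatedP/boundary_sep.
rewrite inE cardA eqxx; apply/asboolP; split=> // B [sepB cardB].
have [|_ sBS] := closer B sepB; first by rewrite cardB -minA cardA.
by apply/separatedP/(subset_trans sBS)/separatedP/boundary_sep.
Qed.

End Cuts.

(** * A topological numbering of the edges *)

Section TopologicalRank.
Variables (V E : finType) (tl hd : E -> V).
Hypothesis acyc : acyclic tl hd.

Definition edge_rank (e : E) : nat := #|[set d | connect (econs tl hd) d e]|.

Lemma edge_rank_gt0 e : 0 < edge_rank e.
Proof. by apply/card_gt0P; exists e; rewrite inE connect0. Qed.

Lemma edge_rank_max e : edge_rank e <= #|E|.
Proof. exact: max_card. Qed.

Lemma edge_rank_lt d e : econs tl hd d e -> edge_rank d < edge_rank e.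
Proof.
move=> de; apply/proper_card/properP; split.
  apply/subsetP=> c; rewrite !inE => cd.
  exact: connect_trans cd (connect1 de).
exists e; rewrite !inE ?connect0 //; apply/negP=> /connectP[p pth lastp].
by apply: (acyc pth); rewrite -lastp; apply/eqP.
Qed.

End TopologicalRank.

(** * Extended global encoding kernels *)

Section Kernels.
Variables (V E : finType) (tl hd : E -> V) (F : fieldType) (s : V) (omega : nat).
Hypothesis acyc : acyclic tl hd.

Local Open Scope ring_scope.

(* [inl i] stands for the imaginary source edge d_i'. As an edge, [inr e] is the
   network edge e; as a coordinate, it is the error edge e'. *)
Local Notation D := ('I_omega + E)%type.
Implicit Types (x y : D) (e a : E) (k : D -> E -> F).

Definition feeds (y : D) (e : E) : bool :=
  match y with inl _ => tl e == s | inr d => econs tl hd d e end.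

Definition ext_rank (y : D) : nat :=
  if y is inr d then edge_rank tl hd d else 0%N.

Lemma feeds_rank y e : feeds y e -> (ext_rank y < edge_rank tl hd e)%N.
Proof. by case: y => [i _|d /(edge_rank_lt acyc)//]; apply: edge_rank_gt0. Qed.

Lemma feeds_ind (P : D -> Prop) :
  (forall i, P (inl i)) -> (forall e, (forall y, feeds y e -> P y) -> P (inr e)) ->
  forall y, P y.
Proof.
move=> Pl Pr y; have [n] := ubnP (ext_rank y); elim: n y => // n IH [i|e] // le_n.
by apply: Pr => y ye; apply/IH/(leq_trans (feeds_rank ye)).
Qed.

Lemma feeds_rev_ind (P : D -> Prop) :
  (forall y, (forall e, feeds y e -> P (inr e)) -> P y) -> forall y, P y.
Proof.
move=> step y; have [n] := ubnP (#|E| - ext_rank y)%N; elim: n y => // n IH y le_n.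
apply: step => e ye; apply: IH.
have lt_ye := feeds_rank ye; apply: leq_trans (le_n : _ <= n)%N.
by rewrite ltn_sub2l // (leq_trans lt_ye) // edge_rank_max.
Qed.

Definition gk k : kernel E F omega :=
  gkernel tl hd s (fun i => k (inl i)) (fun d => k (inr d)).

Definition ext_gk k (y x : D) : F :=
  match y with inl i => (x == inl i)%:R | inr e => gk k e x end.

Lemma gk_stepE k (f : kernel E F omega) e x :
  gk_step tl hd s (fun i => k (inl i)) (fun d => k (inr d)) f e x =
    \sum_(y | feeds y e) k y e * (match y with inl i => (x == inl i)%:R | inr d => f d x end)
      + (x == inr e)%:R.
Proof.
rewrite /gk_step; congr (_ + _); rewrite big_sumType /=; congr (_ + _).
by case: (tl e == s) => //; rewrite big_pred0.
Qed.

(** The value at an edge no longer changes once the number of iterations reaches its rank. Ranks are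
    at most [#|E|], so one further iteration changes nothing and exhibits the recursion. *)
Lemma ext_gkE k e x :
  ext_gk k (inr e) x = \sum_(y | feeds y e) k y e * ext_gk k y x + (x == inr e)%:R.
Proof.
pose it n := iter n (gk_step tl hd s (fun i => k (inl i)) (fun d => k (inr d)))
  (fun _ _ => 0).
have stable n m d : (edge_rank tl hd d <= n)%N -> (edge_rank tl hd d <= m)%N ->
    it n d x = it m d x.
  elim: n m d => [|n IH] m d; first by rewrite leqNgt edge_rank_gt0.
  case: m => [|m] dn dm; first by rewrite leqNgt edge_rank_gt0 in dm.
  rewrite /it !iterS !gk_stepE; congr (_ + _); apply: eq_bigr => -[i|c] // /feeds_rank/= cd.
  by congr (_ * _); apply: IH; rewrite -ltnS (leq_trans cd).
rewrite /ext_gk /gk /gkernel -[LHS]/(it #|E| e x).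
rewrite (stable _ #|E|.+1) ?edge_rank_max ?(leqW (edge_rank_max _ _ _)) //.
by rewrite /it iterS gk_stepE.
Qed.

Lemma recursion_unique k (b : E -> F) (g h : D -> F) :
  (forall i, g (inl i) = h (inl i)) ->
  (forall e, g (inr e) = \sum_(y | feeds y e) k y e * g y + b e) ->
  (forall e, h (inr e) = \sum_(y | feeds y e) k y e * h y + b e) ->
  g =1 h.
Proof.
move=> eql gE hE; apply: feeds_ind => // e IH; rewrite gE hE; congr (_ + _).
by apply: eq_bigr => y ye; rewrite IH.
Qed.

Lemma ext_gk_later k y e :
  (ext_rank y < edge_rank tl hd e)%N -> ext_gk k y (inr e) = 0.
Proof.
elim/feeds_ind: y => [i|d IH] //= lt_de.
rewrite -[LHS]/(ext_gk k (inr d) (inr e)) ext_gkE big1 => [|y yd]; last first.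
  by rewrite IH ?mulr0 // (ltn_trans (feeds_rank yd)).
rewrite add0r; case: eqP => // -[ed]; by rewrite ed ltnn in lt_de.
Qed.

(** The kernel sums the weights of the paths from [x] to [y]. The defining recursion splits off the
    last edge of a path, this one the first; both sides satisfy the same recursion in [y]. *)
Lemma ext_gk_first_step k y x :
  ext_gk k y x = \sum_(e | feeds x e) k x e * ext_gk k y (inr e) + (x == y)%:R.
Proof.
apply: (@recursion_unique k (fun e => (x == inr e)%:R)
  (fun y => ext_gk k y x)
  (fun y => \sum_(e | feeds x e) k x e * ext_gk k y (inr e) + (x == y)%:R)).
- by move=> i /=; rewrite big1 ?add0r // => e _; rewrite mulr0.
- by move=> e; rewrite ext_gkE.
move=> a; congr (_ + _).
under [RHS]eq_bigr do rewrite mulrDr mulr_sumr.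
rewrite big_split exchange_big /=.
under eq_bigr do rewrite -[gk k a _]/(ext_gk k (inr a) _) ext_gkE mulrDr.
rewrite big_split /=; congr (_ + _).
  apply: eq_bigr => e _; rewrite mulr_sumr; apply: eq_bigr => y' _.
  by rewrite mulrCA.
(* Both remaining sums reduce to the direct link from [x] to [a]. *)
transitivity (if feeds x a then k x a else 0).
  case: ifP => xa.
    rewrite (bigD1 a) //= eqxx mulr1 big1 ?addr0 // => e /andP[_ ea].
    by rewrite (inj_eq (@inr_inj _ _)) (negPf ea) mulr0.
  rewrite big1 // => e xe; rewrite (inj_eq (@inr_inj _ _)); case: eqP => [ea|_].
    by rewrite ea xa in xe.
  by rewrite mulr0.
case: ifP => xa.
  rewrite (bigD1 x) //= eqxx mulr1 big1 ?addr0 // => y' /andP[_ yx].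
  by rewrite eq_sym (negPf yx) mulr0.
rewrite big1 // => y' ya; case: eqP => [xy|_]; last by rewrite mulr0.
by rewrite xy ya in xa.
Qed.

Definition update k (d0 : D) (e0 : E) (c : F) : D -> E -> F :=
  fun y e => if (y == d0) && (e == e0) then c else k y e.

(* Acyclicity makes the kernels affine in each single coefficient. *)
Lemma ext_gk_update k d0 e0 c y x :
  ext_gk (update k d0 e0 c) y x =
  ext_gk k y x
    + (feeds d0 e0)%:R * (c - k d0 e0) * (ext_gk k d0 x * ext_gk k y (inr e0)).
Proof.
set b := _ * (c - _).
apply: (@recursion_unique (update k d0 e0 c) (fun e => (x == inr e)%:R)
  (fun y => ext_gk (update k d0 e0 c) y x)
  (fun y => ext_gk k y x + b * (ext_gk k d0 x * ext_gk k y (inr e0)))).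
- by move=> i /=; rewrite !mulr0 addr0.
- by move=> e; rewrite ext_gkE.
move=> e; rewrite [in LHS]ext_gkE [ext_gk k (inr e) (inr e0)]ext_gkE.
rewrite addrAC; congr (_ + _).
(* At the changed coefficient itself the kernel of [d0] has no component at the error edge of [e0],
   so no term quadratic in [c] arises. *)
have kE y' : feeds y' e ->
    update k d0 e0 c y' e * (ext_gk k y' x + b * (ext_gk k d0 x * ext_gk k y' (inr e0)))
    = k y' e * ext_gk k y' x + b * ext_gk k d0 x * (k y' e * ext_gk k y' (inr e0))
      + ((y' == d0) && (e == e0))%:R * b * ext_gk k d0 x.
  move=> ye; rewrite /update; case: ifP => [/andP[/eqP yd /eqP ee]|_]; last first.
    by rewrite !mul0r addr0; ring.
  subst y' e; rewrite (ext_gk_later k (feeds_rank ye)) /b ye !mulr0 !mul1r !addr0.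
  by rewrite -mulrDl addrC subrK.
rewrite (eq_bigr _ kE) !big_split /= -mulr_sumr -addrA; congr (_ + _).
rewrite mulrA mulrDr; congr (_ + _).
rewrite (inj_eq (@inr_inj _ _)) [e0 == e]eq_sym; case: (eqVneq e e0) => [ee|_]; last first.
  by rewrite mulr0 big1 // => y' _; rewrite andbF !mul0r.
rewrite mulr1 ee; case: (boolP (feeds d0 e0)) => [de|]; last first.
  move=> nde; rewrite /b (negPf nde) !mul0r big1 // => y' _; by rewrite !(mul0r, mulr0).
rewrite (bigD1 d0) //= eqxx !mul1r big1 ?addr0 // => y' /andP[_ /negPf->].
by rewrite !mul0r.
Qed.

End Kernels.

(** * Rank-one perturbations *)

Section RankOne.
Variable F : fieldType.
Local Open Scope ring_scope.

Lemma row_freePn m n (M : 'M[F]_(m, n)) :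
  ~~ row_free M -> exists2 w : 'rV_m, w != 0 & w *m M = 0.
Proof.
by rewrite -kermx_eq0 => /rowV0Pn[w /sub_kermxP wM w0]; exists w.
Qed.

(* With a right inverse N of M, the determinant of (M + c u v) N is the affine
   function 1 + c (v N u) of c. *)
Lemma row_free_rank_one m n (M : 'M[F]_(m, n)) (u : 'cV_m) (v : 'rV_n) (a b : F) :
    row_free M ->
    ~~ row_free (M + a *: (u *m v)) -> ~~ row_free (M + b *: (u *m v)) -> a = b.
Proof.
move=> /row_freeP[N MN]; pose r := (v *m N *m u) 0 0.
(* A left kernel vector satisfies w = - c (w u) v N. Multiplying by u and cancelling w u, which is
   nonzero because w is, gives c r = -1. *)
have root c : ~~ row_free (M + c *: (u *m v)) -> c * r = -1.
  case/row_freePn=> w w0 wM.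
  have wE : w = - (c * (w *m u) 0 0) *: (v *m N).
    have /(congr1 (mulmx^~ N)) := wM; rewrite mul0mx mulmxDr mulmxDl -mulmxA MN mulmx1.
    move/eqP; rewrite addr_eq0 => /eqP wE; rewrite {1}wE scaleNr; congr (- _).
    rewrite -scalemxAr -scalemxAl mulmxA -(mulmxA (w *m u)).
    by rewrite {1}[w *m u]mx11_scalar mul_scalar_mx scalerA.
  have z0 : (w *m u) 0 0 != 0.
    by apply: contra w0 => /eqP z0; rewrite wE z0 mulr0 oppr0 scale0r.
  have : (w *m u) 0 0 = - (c * (w *m u) 0 0) * r.
    by rewrite {1}wE -scalemxAl mxE.
  rewrite mulNr mulrAC -mulNr => /eqP; rewrite -subr_eq0 -{1}[_ 0 0]mul1r -mulrBl.
  by rewrite mulf_eq0 (negPf z0) orbF opprK addrC addr_eq0 => /eqP.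
move=> /root ar /root br.
have r0 : r != 0.
  apply/eqP=> r0; move: ar => /eqP; rewrite r0 mulr0 eq_sym oppr_eq0.
  by rewrite (negPf (oner_neq0 _)).
by apply: (mulIf r0); rewrite ar br.
Qed.

End RankOne.

(** * Choosing the variables one at a time *)

(* The values can be fixed one variable at a time: a property that can still be
   met excludes at most one value of the next variable. *)
Lemma common_point (X I : finType) (F : finFieldType) (J : {set I})
    (P : I -> (X -> F) -> Prop) :
    #|J| < #|F| ->
    (forall i, i \in J -> exists g, P i g) ->
    (forall i g x a b, P i g -> ~ P i (fun y => if y == x then a else g y) ->
       ~ P i (fun y => if y == x then b else g y) -> a = b) ->
  exists g, forall i, i \in J -> P i g.
Proof.
move=> ltJ exP affine.
(* Invariant: on the variables fixed so far, [g] agrees with a witness for each [i]. The witnesses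
   may differ elsewhere, and no freedom is left once all variables are fixed. *)
suff [g Hg] : exists g, forall i, i \in J ->
    exists2 h, P i h & {in enum X, g =1 h}.
  exists g => i /Hg[h Ph gh]; suff -> : g = h by [].
  by apply/funext=> x; apply: gh; rewrite mem_enum.
elim: (enum X) => [|x r [g IH]].
  by exists (fun=> 0%R) => i /exP[h Ph]; exists h.
have [|h hP] := @choice _ _ (fun i h => i \in J -> P i h /\ {in r, g =1 h}).
  move=> i; case: (boolP (i \in J)) => [/IH[h Ph gh]|_]; first by exists h.
  by exists g.
pose fail i c := `[< ~ P i (fun y => if y == x then c else h i y) >].
(* By [affine] at most one value fails for each [i], so picking one failing value collects them all;
   the default 0 only fills in when none fails. *)
pose bad := [set odflt 0%R [pick c | fail i c] | i in J].
have [c cgood] : exists c, c \notin bad.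
  apply/existsP; rewrite -negb_forall; apply/negP => /forallP all_bad.
  have: #|F| <= #|bad| by apply/subset_leq_card/subsetP=> c _.
  by move/leq_trans/(_ (leq_imset_card _ _)); rewrite leqNgt ltJ.
exists (fun y => if y == x then c else g y) => i iJ; have [Ph gh] := hP i iJ.
exists (fun y => if y == x then c else h i y) => [|y]; last first.
  by rewrite inE; case: eqP => //= _ /gh.
apply: contrapT => nP; case/negP: cgood; apply/imsetP; exists i => //.
case: pickP => [c' /asboolP nP'|/(_ c)]; first exact: affine Ph nP nP'.
by move/negP; case; apply/asboolP.
Qed.

(** * Message and error spaces at a sink; the Singleton bound *)

Section Codes.
Variables (V E : finType) (tl hd : E -> V) (F : fieldType) (s : V) (omega : nat).
Hypothesis acyc : acyclic tl hd.

Local Open Scope ring_scope.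
Local Notation D := ('I_omega + E)%type.
Local Notation feeds := (@feeds V E tl hd s omega).
Local Notation ext_gk := (@ext_gk V E tl hd F s omega).
Implicit Types (x y : D) (e a : E) (k : D -> E -> F).

Definition t_row k t (x : D) :=
  row_t tl hd s (fun i => k (inl i)) (fun d => k (inr d)) t x.
Definition Phi k t := PhiM tl hd s (fun i => k (inl i)) (fun d => k (inr d)) t.
Definition Delta k t xi := DeltaM tl hd s (fun i => k (inl i)) (fun d => k (inr d)) t xi.

Lemma t_rowE k t x j : t_row k t x 0 j = ext_gk k (inr (enum_val j)) x.
Proof. by rewrite mxE. Qed.

(** An edge entering [t] would contribute a further unit entry in its own column. *)
Lemma t_row_first_step k t (x : D) :
    (if x is inr e then hd e != t else true) ->
  t_row k t x = \sum_(e | feeds x e) k x e *: t_row k t (inr e).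
Proof.
move=> xt; apply/rowP=> j; rewrite t_rowE summxE ext_gk_first_step //.
rewrite (_ : (x == _) = false) ?addr0.
  by apply: eq_bigr => e _; rewrite mxE t_rowE.
apply/eqP=> xj; move: xt; rewrite xj.
by have := enum_valP j; rewrite inE => ->.
Qed.

(** Expanding a row by first steps stays inside the closure of [A] and stops at edges of [A]; no
    path reaches [t] before that. *)
Lemma t_row_separated k t (A : {set E}) (x : D) :
    (if x is inr e then e \in separated tl hd A t
     else [set e | tl e == s] \subset separated tl hd A t) ->
  (t_row k t x <= Delta k t A)%MS.
Proof.
elim/(@feeds_rev_ind V E tl hd s omega acyc): x => x IH xA.
have step : (if x is inr e then hd e != t else true) ->
    (forall e, feeds x e -> e \in separated tl hd A t) ->
    (t_row k t x <= Delta k t A)%MS.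
  move=> xt next; rewrite t_row_first_step //; apply: summx_sub => e xe.
  by apply/scalemx_sub/IH => //; apply: next.
case: x xA {IH} step => [i /subsetP sA|e eA] step.
  by apply: step => // e; rewrite /feeds => ?; apply: sA; rewrite inE.
case: (boolP (e \in A)) => eNA; last first.
  apply: step; first exact: separated_head eA eNA.
  by move=> f; apply: separated_next eA eNA.
apply: (eq_row_sub (enum_rank_in eNA e)).
by rewrite rowK enum_rankK_in.
Qed.

Lemma Delta_sub k t (A xi : {set E}) :
  sep_from tl hd A xi t -> (Delta k t xi <= Delta k t A)%MS.
Proof.
move=> /separatedP/subsetP sA; apply/row_subP=> i; rewrite rowK.
by apply: t_row_separated; apply/sA/enum_valP.
Qed.

Lemma Phi_sub k t (A : {set E}) :
  sep_nodes tl hd A s t -> (Phi k t <= Delta k t A)%MS.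
Proof.
move=> sepA; apply/row_subP=> i; rewrite rowK.
apply: t_row_separated; apply/separatedP=> e p pth; rewrite inE => /eqP.
exact: sepA.
Qed.

Lemma dmin_le k t : \rank (Phi k t) = omega -> (0 < omega)%N ->
  (omega <= mincut_nodes tl hd s t)%N ->
  (dmin tl hd s (fun i => k (inl i)) (fun d => k (inr d)) t
     <= mincut_nodes tl hd s t - omega + 1)%N.
Proof.
move=> rkPhi omega0; have [A sepA <-] := mincut_nodes_attained tl hd s t => leA.
have /submxP[W PhiE] := Phi_sub k sepA.
have le_pred : (omega.-1 <= #|A|)%N by rewrite (leq_trans (leq_pred _)).
(* The first [omega - 1] cut coordinates of the messages. Having fewer columns than rows, [W'] is
   annihilated by a nonzero message [w]. *)
pose W' := colsub (widen_ord le_pred) W.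
have [|w w0 wW'] := @row_freePn _ _ _ W'.
  rewrite /row_free neq_ltn; apply/orP; left.
  by rewrite (leq_ltn_trans (rank_leq_col _)) // prednK.
(* The support of the cut coordinates of [w] misses the first [omega - 1] positions. The
   corresponding cut edges form the error pattern whose space contains the row of [w] at [t]. *)
pose J := [set j : 'I_#|A| | (w *m W) 0 j != 0].
pose xi := [set enum_val j | j in J].
have card_xi : (#|xi| <= #|A| - omega + 1)%N.
  rewrite (leq_trans (leq_imset_card _ _)) //.
  have arith (n j c o : nat) :
      (o <= n -> 0 < o -> o.-1 + c = n -> j <= c -> j <= n - o + 1)%N by lia.
  apply: (arith _ _ #|~: [set widen_ord le_pred j | j : 'I_omega.-1]|) => //.
    rewrite -[RHS]card_ord -(cardsC [set widen_ord le_pred j | j : 'I_omega.-1]).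
    by rewrite card_imset ?card_ord // => i j /(congr1 val)/= /val_inj.
  apply/subset_leq_card/subsetP=> j; rewrite !inE; apply: contra => /imsetP[i _ ->].
  move/rowP/(_ i): wW'; rewrite !mxE => wi; apply/eqP; rewrite -[RHS]wi.
  by apply: eq_bigr => l _; rewrite mxE.
apply: leq_trans card_xi.
apply: (@bigminn_le _ _ _ (fun xi : {set E} => #|xi|)).
apply/rowV0Pn; exists (w *m Phi k t).
  rewrite sub_capmx submxMl /= PhiE mulmxA mulmx_sum_row.
  apply: summx_sub => j _; rewrite rowK.
  case: (boolP (j \in J)) => [jJ|]; last first.
    by rewrite inE negbK => /eqP->; rewrite scale0r sub0mx.
  apply: scalemx_sub.
  have jxi : enum_val j \in xi by apply: imset_f.
  apply: (eq_row_sub (enum_rank_in jxi (enum_val j))).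
  by rewrite rowK enum_rankK_in.
apply: contra w0 => /eqP wPhi.
have: row_free (Phi k t) by rewrite /row_free rkPhi.
by move/row_free_inj/(_ 0 w); rewrite wPhi mul0mx => ->.
Qed.

End Codes.

(** * Disjoint paths and codes for a single error pattern *)

Section Linkage.
Variables (V E : finType) (tl hd : E -> V) (F : fieldType) (s : V) (omega : nat).
Hypothesis acyc : acyclic tl hd.

Local Open Scope ring_scope.
Local Notation D := ('I_omega + E)%type.
Local Notation feeds := (@feeds V E tl hd s omega).
Local Notation ext_gk := (@ext_gk V E tl hd F s omega).
Implicit Types (x y : D) (e a : E) (k : D -> E -> F) (t : V) (xi : {set E}).

Definition stack k t xi : 'M[F]_(omega + #|xi|, #|In_edges hd t|) :=
  col_mx (@Phi V E tl hd F s omega k t) (@Delta V E tl hd F s omega k t xi).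

Definition stack_index xi (i : 'I_(omega + #|xi|)) : D :=
  match split i with inl i => inl i | inr j => inr (enum_val j) end.

Lemma stack_index_inj xi : injective (@stack_index xi).
Proof.
move=> i j; rewrite /stack_index => eq_ij; apply: (can_inj splitK).
by case: (split i) (split j) eq_ij => i' [] j' // [] => [->|/enum_val_inj->].
Qed.

Lemma mem_stack_index xi (x : D) :
  (x \in [set stack_index i | i : 'I_(omega + #|xi|)]) =
  if x is inr e then e \in xi else true.
Proof.
apply/imsetP/idP => [[i _ ->]|].
  by rewrite /stack_index; case: (split i) => // j; apply: enum_valP.
case: x => [i _|e exi].
  by exists (unsplit (inl i)) => //; rewrite /stack_index unsplitK.
exists (unsplit (inr (enum_rank_in exi e))) => //.
by rewrite /stack_index unsplitK enum_rankK_in.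
Qed.

Lemma stackE k t xi i j :
  stack k t xi i j = ext_gk k (inr (enum_val j)) (stack_index i).
Proof. by rewrite mxE /stack_index; case: (split i) => i'; rewrite !mxE. Qed.

(** Full rank of the sum leaves no room in the dimension formula for a smaller message rank or a
    nonzero intersection. *)
Lemma stack_row_free k t xi : row_free (stack k t xi) ->
  \rank (@Phi V E tl hd F s omega k t) = omega /\
  (@Phi V E tl hd F s omega k t :&: @Delta V E tl hd F s omega k t xi = 0%R)%MS.
Proof.
move=> free; have := mxrank_sum_cap (Phi tl hd s k t) (Delta tl hd s k t xi).
rewrite addsmxE (eqP free : \rank (col_mx _ _) = _).
have := rank_leq_row (Phi tl hd s k t); have := rank_leq_row (Delta tl hd s k t xi).
move=> leD leP eq_rk; split; first by lia.
by apply/eqP; rewrite -mxrank_eq0; apply/eqP; lia.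
Qed.

(** The rank-one term is the product of the transfer from the rows to [d0] and the transfer from
    [e0] to the edges entering [t]. *)
Lemma stack_update k t xi d0 e0 (a b : F) :
    row_free (stack k t xi) ->
    ~~ row_free (stack (update k d0 e0 a) t xi) ->
    ~~ row_free (stack (update k d0 e0 b) t xi) ->
  a = b.
Proof.
pose u : 'cV[F]_(omega + #|xi|) :=
  \col_i ((feeds d0 e0)%:R * ext_gk k d0 (stack_index i)).
pose v : 'rV[F]_#|In_edges hd t| := \row_j ext_gk k (inr (enum_val j)) (inr e0).
have updE c : stack (update k d0 e0 c) t xi = stack k t xi + (c - k d0 e0) *: (u *m v).
  apply/matrixP=> i j; rewrite stackE ext_gk_update // [RHS]mxE stackE.
  by congr (_ + _); rewrite !mxE big_ord1 !mxE; ring.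
rewrite !updE => free /(row_free_rank_one free) na /na.
exact: addIr.
Qed.

(* An injective map sending every non-terminal edge outside the sources, to
   itself or to an edge that it feeds, is the same thing as a family of disjoint
   paths from all the sources to [t]: Hall's condition for it is the cut
   condition, and acyclicity forces the chains it defines to end at [t]. *)
Lemma linkage_code t xi :
    #|xi| = mincut_from tl hd xi t ->
    (omega + #|xi| <= mincut_nodes tl hd s t)%N ->
  exists k, row_free (stack k t xi).
Proof.
move=> mincut_xi le_cut.
pose I := [set stack_index i | i : 'I_(omega + #|xi|)].
have cardI : #|I| = (omega + #|xi|)%N.
  by rewrite card_imset ?card_ord //; apply: stack_index_inj.
pose out := [set y : D | if y is inr a then hd a == t else false].
pose N (y : D) : {set D} := y |: [set inr e | e in feeds y].
have hall (Y : {set D}) : Y \subset ~: out ->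
    (#|Y| <= #|\bigcup_(y in Y) (N y :\: I)|)%N.
  move=> /subsetP Yout.
  have -> : \bigcup_(y in Y) (N y :\: I) = (\bigcup_(y in Y) N y) :\: I.
    apply/setP=> z; rewrite inE; apply/bigcupP/andP.
      by case=> y yY; rewrite inE => /andP[? ?]; split=> //; apply/bigcupP; exists y.
    by case=> zI /bigcupP[y yY zy]; exists y => //; rewrite inE zI.
  set NY := \bigcup_(y in Y) N y.
  (* [A] is the cut read off from [Y]: since [Y] has no edge entering [t], every path to [t] that
     starts in [I :|: NY] must leave [Y], and it does so in [A]. *)
  pose A := (I :|: NY) :\: Y; pose AE := [set e | inr e \in A].
  have YNY : Y \subset NY.
    by apply/subsetP=> y yY; apply/bigcupP; exists y; rewrite // !inE eqxx.
  have hit e0 p : path (econs tl hd) e0 p -> hd (last e0 p) = t ->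
      inr e0 \in I :|: NY -> exists2 e, e \in e0 :: p & e \in AE.
    elim: p e0 => [|f p IH] e0 pth ht e0IN.
      exists e0; rewrite ?mem_head // inE inE e0IN andbT.
      by apply/negP=> /Yout; rewrite !inE => /negP; apply; apply/eqP.
    move: pth => /= /andP[e0f pth].
    case: (boolP (inr e0 \in Y)) => e0Y; last first.
      by exists e0; rewrite ?mem_head // inE inE e0IN andbT.
    have [||e ep eA] := IH f pth; rewrite //.
      rewrite inE; apply/orP; right; apply/bigcupP; exists (inr e0) => //.
      by rewrite !inE; apply/orP; right; apply/imsetP; exists f.
    by exists e => //; rewrite inE ep orbT.
  have geA : (#|I| <= #|A|)%N.
    rewrite cardI; have leAE : (#|AE| <= #|A|)%N.
      rewrite -(card_imset (mem AE) (@inr_inj 'I_omega E)).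
      by apply/subset_leq_card/subsetP=> z /imsetP[e]; rewrite inE => ? ->.
    (* A source edge outside [A] lies in [Y], so all edges leaving [s] are in [NY] and [AE] cuts [t]
       from [s]. Otherwise [A] contains all [omega] source edges, and [AE] still cuts [t] from
       [xi]. *)
    case: (pickP (fun i : 'I_omega => inl i \notin A)) => [i iA|inA].
      apply: leq_trans le_cut (leq_trans _ leAE); apply: mincut_nodes_le.
      move=> e0 p pth te0 ht; apply: hit => //.
      have iY : inl i \in Y.
        by move: iA; rewrite inE negb_and negbK !inE mem_stack_index orbF.
      rewrite inE; apply/orP; right; apply/bigcupP; exists (inl i) => //.
      by rewrite !inE; apply/orP; right; apply/imsetP; exists e0 => //; apply/eqP.
    have disj : [disjoint [set inl i | i : 'I_omega] & [set inr e | e in AE]].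
      by apply/pred0P=> z /=; apply/negP=> /andP[/imsetP[i _ ->] /imsetP[]].
    have sepAE : sep_from tl hd AE xi t.
      move=> e0 p pth e0xi ht; apply: hit => //.
      by rewrite inE mem_stack_index e0xi.
    rewrite mincut_xi (leq_trans (_ : _ <= omega + #|AE|)%N) ?leq_add2l ?mincut_from_le //.
    have <- : #|[set inl i | i : 'I_omega] :|: [set inr e | e in AE] : {set D}|
        = (omega + #|AE|)%N.
      rewrite cardsU disjoint_setI0 // cards0 subn0.
      rewrite card_imset ?card_imset ?card_ord //; first exact: inr_inj.
      exact: inl_inj.
    apply/subset_leq_card/subsetP=> z; rewrite inE => /orP[] /imsetP[x xP ->].
      by apply/negPn; rewrite inA.
    by move: xP; rewrite inE.
  have sYIN : Y \subset I :|: NY by rewrite (subset_trans YNY) ?subsetUr.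
  have := cardsD (I :|: NY) Y; have := subset_leq_card sYIN.
  rewrite (setIidPr sYIN) -/A.
  have -> : #|I :|: NY| = (#|I| + #|NY :\: I|)%N.
    rewrite cardsU cardsD [NY :&: I]setIC addnBA //.
    exact/subset_leq_card/subsetIr.
  have arith (i a y n : nat) : (i <= a -> y <= i + n -> a = i + n - y -> y <= n)%N by lia.
  exact: arith.
have [f [fN finj]] := hall_marriage hall.
(* Coefficient 1 exactly where [f] moves [y] to another edge; the fixed points of [f] lie on no
   path. *)
pose k (y : D) (e : E) : F :=
  [&& y \notin out, f y == Some (inr e) & y != inr e]%:R.
have kI y e : inr e \in I -> k y e = 0.
  move=> eI; rewrite /k; case: (boolP (y \in out)) => //= yout.
  have [|z -> ] := fN y; first by rewrite inE.
  rewrite inE => /andP[zI _]; case: eqP => //= -[ze].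
  by rewrite ze eI in zI.
exists k; apply: inj_row_free => w w0.
(* The symbol carried by [y] when the starting points inject the entries of [w]; it vanishes on the
   edges entering [t]. *)
pose g y := \sum_i w 0 i * ext_gk k y (stack_index i).
have gE e : g (inr e) = \sum_(y | feeds y e) k y e * g y
    + \sum_i w 0 i * (stack_index i == inr e)%:R.
  rewrite /g; under eq_bigr do rewrite ext_gkE // mulrDr mulr_sumr.
  rewrite big_split exchange_big /=; congr (_ + _); apply: eq_bigr => y _.
  by rewrite mulr_sumr; apply: eq_bigr => i _; rewrite mulrCA.
have g_out y : y \in out -> g y = 0.
  case: y => [i|a]; rewrite inE // => hat.
  have aIn : a \in In_edges hd t by rewrite inE.
  move/rowP/(_ (enum_rank_in aIn a)): w0; rewrite !mxE => w0.
  rewrite -[RHS]w0; apply: eq_bigr => i _.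
  by rewrite stackE enum_rankK_in.
(* Zeros propagate backwards along the paths: if [f] moves [y] to [e], injectivity makes [y] the
   only contributor to [e], so [g] agrees at both, and it keeps [e] from being a fixed point. *)
have g_move y : (y \in out) || (f y != Some y) -> g y = 0.
  elim/(@feeds_rev_ind V E tl hd s omega acyc): y => y IH.
  case: (boolP (y \in out)) => [/g_out//|yout /= fy].
  have yC : y \in ~: out by rewrite inE.
  have [z fyz] := fN y yC; rewrite !inE => /andP[zI].
  case/orP=> [/eqP zy|/imsetP[e ye ze]]; first by rewrite fyz zy eqxx in fy.
  subst z; have neq : y != inr e by rewrite fyz in fy; rewrite eq_sym; apply: contra fy => /eqP->.
  have g0 : g (inr e) = 0.
    apply: IH => //; case: (boolP (inr e \in out)) => //= eout.
    apply: contra neq => /eqP fe; apply/eqP/finj; rewrite ?in_setC //.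
    by rewrite fe fyz.
  move: g0; rewrite gE [X in _ + X]big1 ?addr0 => [|i _]; last first.
    case: eqP => [si|_]; last by rewrite mulr0.
    by case/negP: zI; rewrite -si imset_f.
  rewrite (bigD1 y) //= big1 ?addr0 => [|y' /andP[_ neqy]].
    by rewrite /k yout fyz neq eqxx mul1r.
  rewrite /k; case: and3P => [[y'out /eqP fy' _]|_]; last by rewrite mul0r.
  by case/negP: neqy; apply/eqP/finj; rewrite ?in_setC // fy' fyz.
apply/rowP=> i; rewrite mxE.
have iI : stack_index i \in I by apply: imset_f.
have <- : g (stack_index i) = w 0 i.
  have delta : \sum_j w 0 j * (stack_index j == stack_index i)%:R = w 0 i.
    rewrite (bigD1 i) //= eqxx mulr1 big1 ?addr0 // => j ji.
    by rewrite (inj_eq (@stack_index_inj xi)) (negPf ji) mulr0.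
  rewrite -[RHS]delta; case: (stack_index i) iI => [//|e eI].
  by rewrite gE big1 ?add0r // => y _; rewrite kI // mul0r.
(* The values of [f] avoid [I], so a starting point is never fixed. *)
apply: g_move; case: (boolP (_ \in out)) => //= iout.
have [|z ->] := fN (stack_index i); first by rewrite inE.
by rewrite inE => /andP[zI _]; apply: contra zI => /eqP[->].
Qed.

End Linkage.

(** * Existence of the MDS code *)

Theorem theorem16 (Fq : finFieldType) (V E : finType) (tl hd : E -> V)
    (s : V) (T : {set V}) (omega : nat) :
  acyclic tl hd ->
  (forall e : E, hd e != s) ->
  s \notin T ->
  (forall e : E, tl e \notin T) ->
  (0 < omega)%N ->
  (forall t, t \in T -> omega <= mincut_nodes tl hd s t)%N ->
  (\sum_(t in T) #|A_set tl hd t (mincut_nodes tl hd s t - omega)| < #|Fq|)%N ->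
  exists (ks : 'I_omega -> E -> Fq) (kd : E -> E -> Fq),
    forall t, t \in T ->
      \rank (PhiM tl hd s ks kd t) = omega /\
      dmin tl hd s ks kd t = (mincut_nodes tl hd s t - omega + 1)%N.
Proof.
move=> acyc _ _ _ omega0 le_cut q_large.
pose J := [set p : V * {set E} | (p.1 \in T) &&
  (p.2 \in A_set tl hd p.1 (mincut_nodes tl hd s p.1 - omega))].
have ltJ : #|J| < #|Fq|.
  apply: leq_ltn_trans q_large; under eq_bigr do rewrite -sum1_card.
  rewrite pair_big_dep /= -sum1_card; apply/eq_leq/eq_bigl => p.
  by rewrite inE.
pose curry (g : ('I_omega + E) * E -> Fq) y e := g (y, e).
have [|p pJ|p g [d0 e0] a b free|g gJ] := @common_point _ _ Fq J
  (fun p g => row_free (stack tl hd s (curry g) p.1 p.2)).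
- exact: ltJ.
- move: pJ; rewrite !inE => /and3P[pT /eqP card_p /asboolP[[_ minp] _]].
  have [|k kfree] := @linkage_code V E tl hd Fq s omega acyc p.1 p.2 minp.
    by rewrite card_p subnKC ?le_cut.
  by exists (fun z => k z.1 z.2).
- have updE c : curry (fun y => if y == (d0, e0) then c else g y)
      = update (curry g) d0 e0 c by [].
  by rewrite !updE => /negP na /negP nb; apply: stack_update free na nb.
exists (fun i => curry g (inl i)), (fun d => curry g (inr d)) => t tT.
have cut_t := le_cut t tT.
have lt_cut : mincut_nodes tl hd s t - omega < mincut_nodes tl hd s t.
  by rewrite ltn_subrL omega0 (leq_trans omega0).
have good (xi : {set E}) : #|xi| <= mincut_nodes tl hd s t - omega ->
    \rank (Phi tl hd s (curry g) t) = omega /\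
    (Phi tl hd s (curry g) t :&: Delta tl hd s (curry g) t xi = 0%R)%MS.
  move=> xi_small; have [A AP sepA] := primary_extension xi_small lt_cut.
  have /(gJ (t, A))/stack_row_free[rk cap0] : (t, A) \in J by rewrite inE tT.
  split=> //; apply/eqP; rewrite -submx0 -cap0 capmxS ?submx_refl //.
  exact: Delta_sub.
(* The empty error pattern already gives the rank of the message space. *)
have [|rkPhi _] := good set0; first by rewrite cards0.
split=> //; apply/eqP; rewrite eqn_leq dmin_le //= addn1.
apply: le_bigminn => [|xi].
  (* The default [#|E|.+1] respects the lower bound because the minimum cut has at most [#|E|]
     edges. *)
  by rewrite ltnS (leq_trans (leq_subr _ _)) ?mincut_nodes_max.
by rewrite ltnNge; apply: contra => /good[_ ->].
Qed.
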